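(* Let $\Gamma$ be a finitely generated group and let $G=(V,E)$ be some Cayley graph of $\Gamma$ with graph metric $d$. Then the $L^1$-compression exponent $\alpha_1^*(\Gamma)$ equals the supremum over those $\alpha\in[0,1]$ for which there exists $C>0$ such that for every $p<1$ there exists a general bond percolation $\mathbf{P}$ on $G$, with configuration denoted $\omega$, such that $\mathbf{P}[e\in\omega]>p$ for every $e\in E$ and such that, for some $\beta,\gamma>0$ with $\beta/\gamma\le C$, $$e^{-\beta d(u,v)}\ \le\ \mathbf{P}[u\leftrightarrow v]\ \le\ e^{-\gamma d(u,v)^\alpha}\qquad\text{for every } u,v\in V .$$
   Context: Given a finitely generated group $\Gamma$ and a finite symmetric generating set $S$, the Cayley graph of $\Gamma$ with respect to $S$ is the graph $G=(V,E)$ with $V=\Gamma$ and undirected edges $\{[g,gs]\colon g\in\Gamma,\ s\in S\}$. Its graph metric $d$ (length of a shortest path) is the word metric with respect to $S$. The $L^1$-compression exponent $\alpha_1^*(X)$ of a metric space $(X,d_X)$ is the supremum over all $\alpha\in[0,1]$ such that there exist a measure space $(Y,\nu)$, a Lipschitz function $f\colon X\to L^1(\nu)$ and a constant $c>0$ with $\|f(u)-f(v)\|_1\ge c\,d_X(u,v)^\alpha$ for every $u,v\in X$. For a finitely generated group, $\alpha_1^*(\Gamma)$ is this quantity for $\Gamma$ equipped with some word metric coming from a finite generating set (it does not depend on the choice). In the case $\alpha=0$ the convention $0^0:=0$ is used, so that pairs with $u=v$ impose no restriction. A general bond percolation on $G$ is a probability measure $\mathbf{P}$ on subsets of $E$,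 i.e. on $\{0,1\}^E$ with its Borel $\sigma$-algebra (no invariance is assumed). The configuration $\omega\subset E$ is identified with the induced subgraph with vertex set $V$ and edge set $\omega$; its connected components are called clusters, and $\{u\leftrightarrow v\}$ is the event that $u$ and $v$ lie in the same cluster of $\omega$. *)

(* Defs.v *)
From HB Require Import structures.
From mathcomp Require Import all_boot all_order all_algebra finmap.
From mathcomp Require Import all_classical all_reals all_analysis.

Set Implicit Arguments.
Unset Strict Implicit.
Unset Printing Implicit Defensive.

Import Order.TTheory GRing.Theory Num.Theory.
Import numFieldNormedType.Exports.

Local Open Scope classical_set_scope.
Local Open Scope ring_scope.

(* A graph on the vertex set V is given by its set of edges, an undirected edge
   being the set {x, y} of its endpoints. *)
Definition adjacent (V : Type) (E : set (set V)) : rel V :=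
  fun x y => `[< E [set x; y] >].

Definition is_walk (V : Type) (E : set (set V)) (u v : V) (p : seq V) : Prop :=
  path (adjacent E) u p /\ last u p = v.

Definition same_cluster (V : Type) (E : set (set V)) (u v : V) : Prop :=
  exists p : seq V, is_walk E u v p.

(* Junk value 0 when u and v are not connected; this does not happen in the
   Cayley graph of a generating set. *)
Definition graph_dist (V : Type) (E : set (set V)) (u v : V) : nat :=
  if pselect (exists n, `[< exists2 p, is_walk E u v p & size p = n >])
  is left walk_uv then ex_minn walk_uv else 0%N.

Definition generates (G : groupType) (S : {fset G}) : Prop :=
  forall H : {pred G}, group_closed H -> {subset S <= H} -> H =i predT.

Definition sym_generating (G : groupType) (S : {fset G}) : Prop :=
  invg_closed [in S] /\ generates S.

Definition cayley_edges (G : groupType) (S : {fset G}) : set (set G) :=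
  [set e | exists g s : G, s \in S /\ e = [set g; (g * s)%g]].

Definition word_dist (R : realType) (G : groupType) (S : {fset G})
    (u v : G) : R :=
  (graph_dist (cayley_edges S) u v)%:R.

(* The power d ^ a with the convention 0 ^ 0 = 0 (powR has 0 `^ 0 = 1). *)
Definition dist_pow (R : realType) (d a : R) : R :=
  if d == 0 then 0 else d `^ a.

Definition L1_dist (R : realType) (dY : measure_display)
    (Y : measurableType dY) (nu : {measure set Y -> \bar R})
    (f g : LspaceType1 nu) : \bar R :=
  'N[nu]_1[EFin \o (fun y => (f y : R) - (g y : R))%R]%E.

Definition L1_compressible (R : realType) (X : Type) (dX : X -> X -> R)
    (a : R) : Prop :=
  exists (dY : measure_display) (Y : measurableType dY)
         (nu : {measure set Y -> \bar R}) (f : X -> LspaceType1 nu),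
    (exists L : R, forall u v : X, (L1_dist (f u) (f v) <= (L * dX u v)%:E)%E) /\
    (exists2 c : R, 0 < c &
       forall u v : X,
         ((c * dist_pow (dX u v) a)%:E <= L1_dist (f u) (f v))%E).

Definition L1_compression_exponent (R : realType) (X : Type)
    (dX : X -> X -> R) : R :=
  sup [set a : R | 0 <= a <= 1 /\ L1_compressible dX a].

(* {0,1}^E with the Borel sigma-algebra of the product topology. *)
Definition bond_config (V : Type) (E : set (set V)) :=
  g_sigma_algebraType (@open {ptws E -> bool}).

Definition open_edges (V : Type) (E : set (set V)) (w : bond_config E) :
    set (set V) :=
  [set set_val e | e in [set e : E | w e]].

Definition bond_percolation (R : realType) (V : Type) (E : set (set V)) :=
  probability (bond_config E) R.

Definition percolation_admissible (R : realType) (G : groupType)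
    (S : {fset G}) (a : R) : Prop :=
  exists2 C : R, 0 < C &
    forall p : R, p < 1 ->
    exists P : bond_percolation R (cayley_edges S),
      (forall e : cayley_edges S, (p%:E < P [set w : bond_config (cayley_edges S) | w e])%E) /\
      (exists b c : R,
         [/\ 0 < b, 0 < c, b / c <= C &
          forall u v : G,
            ((expR (- (b * word_dist R S u v)))%:E
               <= P [set w | same_cluster (open_edges w) u v])%E /\
            (P [set w | same_cluster (open_edges w) u v]
               <= (expR (- (c * dist_pow (word_dist R S u v) a)))%:E)%E]).

(* Main.v *)
From HB Require Import structures.
From mathcomp Require Import all_boot all_order all_algebra finmap.
From mathcomp Require Import all_classical all_reals all_analysis.
From mathcomp Require Import measurable_realfun ring lra zify.
Require Import Defs.

Set Implicit Arguments.
Unset Strict Implicit.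
Unset Printing Implicit Defensive.

Import Order.TTheory GRing.Theory Num.Theory.
Import numFieldNormedType.Exports.

Local Open Scope classical_set_scope.
Local Open Scope ring_scope.

(** Both exponents are governed by cut metrics, the functions
    D(u, v) = m(A_u + A_v) where m is a measure, the A_u are measurable sets
    and + is the symmetric difference. These are the distances between points
    of an L1 space: the subgraphs of functions f_u have these distances for
    the product of nu with Lebesgue measure ([L1_subgraphs]), and the functions
    1_{A_u} - 1_{A_o} have them in L1(m) ([cuts_L1]).

    From cuts to percolation. Let a Poisson process with intensity t * m throw
    points on the underlying space, and open the edge uv when none of them
    lies in A_u + A_v. As A_u + A_v is covered by the sets attached to the
    steps of any walk from u to v, an open walk can exist only if A_u + A_v is
    free of points, so u and v are connected with probability at most
    exp(- t D(u, v)). A geodesic is open with probability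
    exp(- t m(union of its steps)), which is at least exp(- t L d(u, v)) when D
    is L-Lipschitz. If moreover D >= c d^alpha then beta / gamma = L / c does
    not depend on t, while t -> 0 brings the probability of each edge to 1.

    The Poisson process enters only through its void probabilities
    exp(- m(A_{i_1} U ... U A_{i_n})). As a function of {i_1, ..., i_n} this is
    completely monotone ([alt_diff_void_prob_ge0]): inclusion-exclusion assigns
    to each finite pattern of void and occupied sets a nonnegative weight.
    These weights are consistent, so dividing [0, 1[ into intervals of the
    prescribed lengths, one set at a time, realizes the whole family of events
    on a Lebesgue space ([bit_event_prob]); [cut_percolation] follows.

    From percolation to cuts. Label each cluster by a natural number. The sets
    {(w, k) : k labels the cluster of u in w}, under the product of P with
    counting measure, have symmetric differences of measure
    2 (1 - P[u <-> v]) ([labelled_setY]). After division by gamma this lies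
    between (2 / gamma) (1 - exp(- gamma d^alpha)) and 2 C d. Moreover
    gamma -> 0 as p -> 1, because p < P[u <-> v] <= exp(- gamma) on an edge. So
    a sum of such cut metrics with weights 2^-n and with gamma_n decreasing
    very fast is Lipschitz. At distance d, the first term with
    gamma_n d^alpha <= 1 is at least a multiple of 2^-n d^alpha, and 2^n is at
    most d^(alpha - alpha') because gamma_{n-1} d^alpha > 1 and gamma_{n-1} has
    been chosen small in terms of n. This yields every exponent alpha' < alpha
    ([mixture_compressible]), which is enough for the suprema to agree. *)

(** * Walks and word metrics *)

Section walks.
Variables (V : Type) (E : set (set V)).

Lemma set2_eq (x y a b : V) : [set x; y] = [set a; b] ->
  (x = a /\ y = b) \/ (x = b /\ y = a).
Proof.
move=> xyab.
have xab : [set a; b] x by rewrite -xyab; left.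
have yab : [set a; b] y by rewrite -xyab; right.
have axy : [set x; y] a by rewrite xyab; left.
have bxy : [set x; y] b by rewrite xyab; right.
case: xab yab axy bxy => [->|->] [->|->] /= [h1|h1] [h2|h2]; subst; intuition.
Qed.

Lemma graph_dist_le u v p : is_walk E u v p -> (graph_dist E u v <= size p)%N.
Proof.
move=> uv; rewrite /graph_dist; case: pselect => [h|h//].
by case: ex_minnP => m _; apply; apply/asboolP; exists p.
Qed.

Lemma graph_dist_walk u v : same_cluster E u v ->
  exists2 p, is_walk E u v p & size p = graph_dist E u v.
Proof.
move=> [p uv]; rewrite /graph_dist; case: pselect => [h|[]].
  by case: ex_minnP => m /asboolP.
by exists (size p); apply/asboolP; exists p.
Qed.

Lemma same_cluster_refl u : same_cluster E u u. Proof. by exists [::]. Qed.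

Lemma same_cluster_trans v u w :
  same_cluster E u v -> same_cluster E v w -> same_cluster E u w.
Proof.
move=> [p [up pv]] [q [vq qw]]; exists (p ++ q); split.
  by rewrite cat_path up pv.
by rewrite last_cat pv.
Qed.

Lemma adjacentC : symmetric (adjacent E).
Proof. by move=> x y; rewrite /adjacent setUC. Qed.

Lemma same_cluster_sym u v : same_cluster E u v -> same_cluster E v u.
Proof.
move=> [p]; elim: p u => [|x p IH] u [/=].
  by move=> _ ->; exact: same_cluster_refl.
move=> /andP[ux xp] pv; apply: (@same_cluster_trans x); first exact: IH.
by exists [:: u]; split => //=; rewrite adjacentC ux.
Qed.

End walks.

Section words.
Variable G : groupType.
Implicit Types (S T : {fset G}) (u v g : G) (w : seq G).
Local Open Scope group_scope.

Definition word_prod w : G := foldr *%g 1%g w.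

Lemma word_prod_cat w1 w2 : word_prod (w1 ++ w2) = word_prod w1 * word_prod w2.
Proof. by elim: w1 => [|x w IH] /=; rewrite ?mul1g// IH mulgA. Qed.

Lemma cayley_adjacent S u v : sym_generating S ->
  adjacent (cayley_edges S) u v <-> exists2 s, s \in S & v = u * s.
Proof.
move=> [Ssym _]; split => [/asboolP[g [s [sS uv]]]|[s sS ->]].
  have [[-> ->]|[-> ->]] := set2_eq uv; first by exists s.
  by exists s^-1; rewrite ?mulgK//; exact: Ssym.
by apply/asboolP; exists u, s.
Qed.

Lemma walk_word S u v p : sym_generating S -> is_walk (cayley_edges S) u v p ->
  exists w, [/\ {subset w <= S}, size w = size p & v = u * word_prod w].
Proof.
move=> gS; elim: p u => [|x p IH] u [/=].
  by move=> _ <-; exists [::]; split => //; rewrite /= mulg1.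
move=> /andP[ux xp] pv.
have [s sS xE] := (cayley_adjacent u x gS).1 ux; subst x.
have [w [wS wp ->]] := IH (u * s) (conj xp pv).
exists (s :: w); split => /=; rewrite ?wp ?mulgA//.
by move=> y; rewrite inE => /predU1P[->//|/wS].
Qed.

Lemma word_walk S u w : sym_generating S -> {subset w <= S} ->
  exists2 p, is_walk (cayley_edges S) u (u * word_prod w) p & size p = size w.
Proof.
move=> gS; elim: w u => [|s w IH] u wS.
  by exists [::] => //; split => //=; rewrite mulg1.
have [|p [up pv] pw] := IH (u * s).
  by move=> y yw; apply: wS; rewrite inE yw orbT.
exists (u * s :: p); last by rewrite /= pw.
split => /=; last by rewrite pv mulgA.
apply/andP; split => //; apply/cayley_adjacent => //.
by exists s => //; apply: wS; rewrite mem_head.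
Qed.

Lemma generated_word S g : sym_generating S ->
  exists2 w, {subset w <= S} & g = word_prod w.
Proof.
move=> [Ssym Sgen].
pose H := [pred g | `[< exists2 w, {subset w <= S} & g = word_prod w >]].
have closed : group_closed H.
  split => [|x y]; first by apply/asboolP; exists [::].
  move=> /asboolP[w1 w1S ->] /asboolP[w2 w2S ->]; apply/asboolP.
  exists (w1 ++ rev ([seq x^-1 | x <- w2])).
    move=> z; rewrite mem_cat mem_rev => /orP[/w1S//|/mapP[t /w2S tS ->]].
    by move: tS; exact: Ssym.
  rewrite word_prod_cat; congr (_ * _).
  elim: w2 {w2S} => [|z w IH] /=; first by rewrite invg1.
  by rewrite invgM rev_cons -cats1 word_prod_cat/= mulg1 IH.
have : g \in H.
  rewrite (Sgen _ closed)// => x xS; apply/asboolP.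
  exists [:: x]; rewrite /= ?mulg1//.
  by move=> y /[!inE] /eqP ->.
by move=> /asboolP.
Qed.

Lemma cayley_connected S u v :
  sym_generating S -> same_cluster (cayley_edges S) u v.
Proof.
move=> gS; have [w wS uv] := generated_word (u^-1 * v) gS.
have [p] := word_walk u gS wS; rewrite -uv mulVKg => uvp _; by exists p.
Qed.

(** Words over the finite set S form a countable type and their values
    exhaust the group. *)
Lemma enumeration S :
  sym_generating S -> exists e : nat -> G, forall g, exists n, e n = g.
Proof.
move=> gS.
exists (fun n => word_prod
  (if @choice.unpickle (seq S) n is Some w then map (@fsval _ S) w else [::])).
move=> g; have [w wS ->] := generated_word g gS.
have [w' ->] : exists w' : seq S, w = map (@fsval _ S) w'.
  elim: w wS => [|s w IH] wS; first by exists [::].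
  have [|w' ->] := IH; first by move=> y yw; apply: wS; rewrite inE yw orbT.
  have sS : s \in S by apply: wS; rewrite mem_head.
  by exists ([` sS]%fset :: w').
by exists (@choice.pickle (seq S) w'); rewrite choice.pickleK.
Qed.

(** Replace each letter of T in a word by a word over S for that letter; K
    bounds the lengths of these finitely many words. *)
Lemma word_metrics_comparable S T : sym_generating S -> sym_generating T ->
  exists K, forall u v,
    (graph_dist (cayley_edges S) u v <= K * graph_dist (cayley_edges T) u v)%N.
Proof.
move=> gS gT.
pose len (t : T) := graph_dist (cayley_edges S) 1%g (fsval t).
pose K := \max_(t : T) len t.
have trans w : {subset w <= T} -> exists w', [/\ {subset w' <= S},
    word_prod w' = word_prod w & (size w' <= K * size w)%N].
  elim: w => [|t w IH] wT; first by exists [::].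
  have [|w' [w'S w'w sw']] := IH.
    by move=> y yw; apply: wT; rewrite inE yw orbT.
  have tT : t \in T by apply: wT; rewrite mem_head.
  have [p pt sp] := graph_dist_walk (cayley_connected 1 t gS).
  have [w1 [w1S sw1]] := walk_word gS pt; rewrite mul1g => t1.
  exists (w1 ++ w'); split.
  - by move=> y; rewrite mem_cat => /orP[/w1S|/w'S].
  - by rewrite word_prod_cat -t1 w'w.
  - rewrite size_cat /= mulnS leq_add// sw1 sp.
    exact: (@leq_bigmax _ len [` tT]%fset).
exists K => u v; have [p uv <-] := graph_dist_walk (cayley_connected u v gT).
have [w [wT <- ->]] := walk_word gT uv.
have [w' [w'S <- sw']] := trans _ wT.
have [q uq sq] := word_walk u gS w'S.
by rewrite (leq_trans (graph_dist_le uq))// sq.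
Qed.

End words.

(** * L1 distances as cut metrics *)

Lemma L1_distE (R : realType) (dY : measure_display) (Y : measurableType dY)
    (nu : {measure set Y -> \bar R}) (f g : LspaceType1 nu) :
  L1_dist f g = (\int[nu]_y `|(f y : R) - (g y : R)|%:E)%E.
Proof. by rewrite /L1_dist Lnorm1. Qed.

Lemma L1_measurable (R : realType) (dY : measure_display)
    (Y : measurableType dY) (nu : {measure set Y -> \bar R})
    (f : LspaceType1 nu) : measurable_fun setT (fun y => f y : R).
Proof.
move=> mT B mB.
have mf := measurable_funPT (repr (f : {mfun_ nu, Y >-> measurableTypeR R})).
exact: mf mT B mB.
Qed.

Lemma measurable_setY d (T : measurableType d) (A B : set T) :
  measurable A -> measurable B -> measurable (A `+` B).
Proof. by move=> mA mB; apply: measurableU; apply: measurableD. Qed.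

Lemma setY_triangle (T : Type) (A B C : set T) :
  A `+` C `<=` (A `+` B) `|` (B `+` C).
Proof. by move=> y /=; have := pselect (B y); tauto. Qed.

Lemma half_lines_setY (R : realType) (a b : R) :
  lebesgue_measure ([set s : R | s < a] `+` [set s | s < b]) = (`|a - b|%:E)%E.
Proof.
wlog ab : a b / a <= b.
  move=> H; case/orP: (le_total a b) => [/H//|/H hb].
  by rewrite setYC hb distrC.
have -> : [set s : R | s < a] `+` [set s | s < b] = `[a, b[%classic.
  apply/seteqP; split => x /=; rewrite in_itv/=.
    move=> [[xa /negP]|[xb /negP]]; rewrite -leNgt => h.
      by have := lt_le_trans xa (le_trans ab h); rewrite ltxx.
    by rewrite h.
  by move=> /andP[ax xb]; right; split => //; apply/negP; rewrite -leNgt.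
rewrite lebesgue_measure_itv/= lte_fin; case: ltP => h.
  by rewrite distrC ger0_norm ?subr_ge0.
have -> : a = b by apply/eqP; rewrite eq_le ab h.
by rewrite subrr normr0.
Qed.

(** The A_u are the subgraphs {(y, s) : s < f_u(y)}: the slice of
    A_u + A_v over y lies between f_u(y) and f_v(y), so Lebesgue measure gives
    it length |f_u(y) - f_v(y)|. The measure nu may fail to be sigma-finite;
    the product measure defined by integrating slices over nu is still a
    measure. *)
Lemma L1_subgraphs (R : realType) (X : Type) (dY : measure_display)
    (Y : measurableType dY) (nu : {measure set Y -> \bar R})
    (f : X -> LspaceType1 nu) :
  exists (d : measure_display) (Z : measurableType d)
    (m : {measure set Z -> \bar R}) (A : X -> set Z),
    (forall u, measurable (A u)) /\
    forall u v, m (A u `+` A v) = L1_dist (f u) (f v).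
Proof.
exists _, (Y * measurableTypeR R)%type,
  [the measure _ _ of product_measure1 nu lebesgue_measure],
  (fun u => [set z | z.2 < (f u z.1 : R)]); split => [u|u v].
  have h1 : measurable_fun setT (fun z : Y * measurableTypeR R => z.2 : R).
    exact: measurable_snd.
  have h2 : measurable_fun setT (fun z : Y * measurableTypeR R => f u z.1 : R).
    apply: (measurableT_comp (f := fun y => f u y : R)) => //.
    exact: L1_measurable.
  have := measurable_fun_ltr h1 h2.
  move/(_ measurableT [set true] I).
  by rewrite setTI; congr measurable; apply/seteqP; split.
rewrite L1_distE /=; apply: eq_integral => y _ /=.
rewrite -half_lines_setY; congr (lebesgue_measure _).
by apply/seteqP; split => s; rewrite /xsection/= ?inE//= ?inE.
Qed.

(** Points of the L1 space are almost-everywhere classes, evaluated through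
    a representative, so a given integrable function is recovered only up to a
    negligible set. *)
Lemma L1_class (R : realType) (dY : measure_display)
    (Y : measurableType dY) (nu : {measure set Y -> \bar R}) (g : Y -> R) :
  measurable_fun setT g -> (\int[nu]_y `|g y|%:E < +oo)%E ->
  exists h : LspaceType1 nu, \forall y \ae nu, h y = g y :> R.
Proof.
move=> mg ig.
have mg' : measurable_fun [set: Y] (g : Y -> measurableTypeR R).
  by move=> mT B mB; exact: mg mT B mB.
pose G : {mfun Y >-> measurableTypeR R} :=
  HB.pack_for {mfun Y >-> measurableTypeR R}
    (g : Y -> measurableTypeR R) (isMeasurableFun.Build _ _ _ _ _ mg').
pose q : {mfun_ nu, Y >-> measurableTypeR R} :=
  (\pi_({mfun_ nu, Y >-> measurableTypeR R}) G)%qT.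
have mq : measurable_fun setT (fun y => q y : R).
  by move=> mT B mB; exact: (measurable_funPT (repr q)) mT B mB.
have qg : \forall y \ae nu, q y = g y :> R.
  have /eqmodP/asboolP :
    (repr q = G %[mod {mfun_ nu, Y >-> measurableTypeR R}])%qT by rewrite reprK.
  by apply: filterS => y /(_ I).
have nq : finite_norm nu 1 (q : Y -> R).
  rewrite /finite_norm Lnorm1 (_ : (\int[nu]_y _ = \int[nu]_y `|g y|%:E)%E) //.
  apply: ae_eq_integral => //.
  - by apply/measurable_EFinP; apply: measurableT_comp.
  - by apply/measurable_EFinP; apply: measurableT_comp.
  - by apply: filterS qg => y yq _; rewrite /= yq.
pose h : LspaceType1 nu := HB.pack_for (LspaceType1 nu)
   q (isFinLebesgue.Build _ _ _ _ _ (@lexx _ _ 1%E) _ nq).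
by exists h.
Qed.

(** The indicator of A_u need not be integrable; subtracting the indicator
    of the reference set A_{u0} makes it so without changing differences. *)
Lemma cuts_L1 (R : realType) (X : Type) (d : measure_display)
    (Z : measurableType d) (m : {measure set Z -> \bar R}) (A : X -> set Z)
    (u0 : X) :
  (forall u, measurable (A u)) ->
  (forall u v, (m (A u `+` A v) < +oo)%E) ->
  exists f : X -> LspaceType1 m,
    forall u v, L1_dist (f u) (f v) = m (A u `+` A v).
Proof.
move=> mA fA; pose g u y : R := \1_(A u) y - \1_(A u0) y.
have indE u v y : `|\1_(A u) y - \1_(A v) y| = \1_(A u `+` A v) y :> R.
  rewrite !indicE.
  have [yu|yu] := pselect (A u y); have [yv|yv] := pselect (A v y).
  - by rewrite (mem_set yu) (mem_set yv) subrr normr0 memNset//= => -[] [].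
  - by rewrite (mem_set yu) (memNset yv) subr0 normr1 mem_set//=; left.
  - by rewrite (memNset yu) (mem_set yv) sub0r normrN normr1 mem_set//=; right.
  - by rewrite (memNset yu) (memNset yv) subrr normr0 memNset//= => -[] [].
have mg u : measurable_fun setT (g u).
  by apply: measurable_funB; exact: measurable_indic.
have ig u : (\int[m]_y `|g u y|%:E < +oo)%E.
  under eq_integral do rewrite indE.
  by rewrite integral_indic ?setIT//; exact: measurable_setY.
have /choice[f fg] u := L1_class (mg u) (ig u).
exists f => u v; rewrite L1_distE.
transitivity (\int[m]_y (\1_(A u `+` A v) y)%:E)%E; last first.
  by rewrite integral_indic ?setIT//; exact: measurable_setY.
apply: ae_eq_integral => //.
- apply/measurable_EFinP; apply: measurableT_comp => //.
  by apply: measurable_funB; exact: L1_measurable.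
- by apply/measurable_EFinP; apply: measurable_indic; exact: measurable_setY.
- have := fg u; have := fg v; apply: filterS2 => y gv gu _.
  by rewrite gu gv -indE /g; congr (`|_|%:E); ring.
Qed.

(** Compressibility without reference to functions; both comparisons with
    percolation go through this form. *)
Definition cut_compressible (R : realType) (X : Type) (dX : X -> X -> R)
    (a : R) :=
  exists (d : measure_display) (Z : measurableType d)
    (m : {measure set Z -> \bar R}) (A : X -> set Z),
    (forall u, measurable (A u)) /\
    exists L c : R, 0 < c /\ forall u v,
      ((c * dist_pow (dX u v) a)%:E <= m (A u `+` A v))%E /\
      (m (A u `+` A v) <= (L * dX u v)%:E)%E.

Lemma L1_compressibleP (R : realType) (X : Type) (dX : X -> X -> R) (a : R) :
  X -> L1_compressible dX a <-> cut_compressible dX a.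
Proof.
move=> u0; split.
  move=> [dY [Y [nu [f [[L fL] [c c0 fc]]]]]].
  have [d [Z [m [A [mA mE]]]]] := L1_subgraphs f.
  exists d, Z, m, A; split => //; exists L, c; split => // u v.
  by rewrite mE.
move=> [d [Z [m [A [mA [L [c [c0 mLc]]]]]]]].
have mfin u v : (m (A u `+` A v) < +oo)%E.
  by apply: le_lt_trans (mLc u v).2 _; rewrite ltry.
have [f fE] := cuts_L1 u0 mA mfin.
exists d, Z, m, f; split; [exists L|exists c => //] => u v; rewrite fE.
  exact: (mLc u v).2.
exact: (mLc u v).1.
Qed.

(** * Completely monotone set functions and void probabilities *)

Section complete_monotonicity.
Variables (R : realType) (I : eqType).
Implicit Types (phi psi : set I -> R) (C : seq I) (O : set I) (c : I).

(** When phi O is the probability that all the events indexed by O occur,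
    inclusion-exclusion makes alt_diff phi C O the probability that all events
    of O and none of C occur. *)
Fixpoint alt_diff phi C O : R :=
  if C is c :: C' then alt_diff phi C' O - alt_diff phi C' (c |` O) else phi O.

Definition completely_monotone phi := forall C O, 0 <= alt_diff phi C O.

Lemma alt_diffD phi psi C O :
  alt_diff (phi \+ psi) C O = alt_diff phi C O + alt_diff psi C O.
Proof. by elim: C O => //= c C IH O; rewrite !IH; ring. Qed.

Lemma alt_diffZ a phi C O : alt_diff (a \*o phi) C O = a * alt_diff phi C O.
Proof. by elim: C O => //= c C IH O; rewrite !IH mulrBr. Qed.

Lemma alt_diff_shift c phi C O :
  alt_diff (fun O => phi (c |` O)) C O = alt_diff phi C (c |` O).
Proof. by elim: C O => //= d C IH O; rewrite !IH setUCA. Qed.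

(** The last difference of the recursion can also be taken first. This turns
    a difference of order n + 1 of phi into one of order n of another
    function, which drives the inductions below. *)
Lemma alt_diff_cons c phi C O :
  alt_diff phi (c :: C) O = alt_diff (phi \- (fun O => phi (c |` O))) C O.
Proof.
rewrite /= -alt_diff_shift; elim: C O => //= d C IH O.
by rewrite -!IH; ring.
Qed.

(** Reduces a statement about infinitely many sets, whose union may have
    infinite measure, to the finitely many sets indexed by O and C. *)
Lemma alt_diff_local phi psi C O :
  (forall O', O `<=` O' -> O' `<=` O `|` [set` C] -> phi O' = psi O') ->
  alt_diff phi C O = alt_diff psi C O.
Proof.
elim: C O => [|c C IH] O agree /=; first by apply: agree => // x; left.
congr (_ - _); apply: IH => O' OO' O'C; apply: agree.
- exact: OO'.
- by move=> x /O'C[|xC]; [left|right; rewrite /= inE xC orbT].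
- by move=> x Ox; apply: OO'; right.
- move=> x /O'C[[->|Ox]|xC]; [right|left|right] => //=; rewrite inE ?eqxx//.
  by rewrite xC orbT.
Qed.

Lemma cm_shift c phi : completely_monotone phi ->
  completely_monotone (fun O => phi (c |` O)).
Proof. by move=> cm C O; rewrite alt_diff_shift. Qed.

Lemma cm_diff c phi : completely_monotone phi ->
  completely_monotone (phi \- (fun O => phi (c |` O))).
Proof. by move=> cm C O; rewrite -alt_diff_cons. Qed.

Lemma cm_cst a : 0 <= a -> completely_monotone (cst a).
Proof.
move=> a0 C.
have [->//|H] : C = [::] \/ forall O, alt_diff (cst a) C O = 0; last first.
  by move=> O; rewrite H.
elim: C => [|c C [->|IH]]; [by left|right..] => O /=; first by rewrite subrr.
by rewrite !IH subrr.
Qed.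

Lemma cmD phi psi : completely_monotone phi -> completely_monotone psi ->
  completely_monotone (phi \+ psi).
Proof. by move=> cphi cpsi C O; rewrite alt_diffD addr_ge0. Qed.

Lemma cmZ a phi : 0 <= a -> completely_monotone phi ->
  completely_monotone (a \*o phi).
Proof. by move=> a0 cphi C O; rewrite alt_diffZ mulr_ge0. Qed.

(** By the Leibniz rule
    D_c(phi psi) = (D_c phi) psi + (T_c phi) (D_c psi), where T_c is the shift
    by c, and both D_c and T_c preserve complete monotonicity. Independent
    families of events have intersection probabilities of this product
    form. *)
Lemma cmM phi psi : completely_monotone phi -> completely_monotone psi ->
  completely_monotone (phi \* psi).
Proof.
move=> cphi cpsi C; elim: C phi psi cphi cpsi => [|c C IH] phi psi cphi cpsi O.
  by rewrite /= mulr_ge0// (cphi [::], cpsi [::]).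
have -> : alt_diff (phi \* psi) (c :: C) O =
    alt_diff (((phi \- (fun O => phi (c |` O))) \* psi)
      \+ ((fun O => phi (c |` O)) \* (psi \- (fun O => psi (c |` O))))) C O.
  rewrite alt_diff_cons; congr alt_diff.
  by apply/funext => O' /=; ring.
rewrite alt_diffD addr_ge0//; apply: IH => //.
- exact: cm_diff.
- exact: cm_shift.
- exact: cm_diff.
Qed.

Lemma cm_limit (phi_ : nat -> set I -> R) phi :
  (forall n, completely_monotone (phi_ n)) ->
  (forall O, phi_ ^~ O @ \oo --> phi O) -> completely_monotone phi.
Proof.
move=> cm lim C O.
have limD : alt_diff (phi_ n) C O @[n --> \oo] --> alt_diff phi C O.
  elim: C O => [|c C IH] O /=; first exact: lim.
  by apply: cvgB; exact: IH.
rewrite -(cvg_lim _ limD)//; apply: limr_ge.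
  by apply/cvg_ex; eexists; exact: limD.
by apply: nearW => n; exact: cm.
Qed.

Lemma cm_expR phi :
  completely_monotone phi -> completely_monotone (expR \o phi).
Proof.
move=> cm.
apply: (@cm_limit (fun n O => series (exp_coeff (phi O)) n)); last first.
  by move=> O; exact: is_cvg_series_exp_coeff.
have cmX k : completely_monotone (fun O => phi O ^+ k).
  elim: k => [|k IH]; first exact: (cm_cst ler01).
  rewrite (_ : (fun O => _) = phi \* (fun O => phi O ^+ k)); first exact: cmM.
  by apply/funext => O; rewrite exprS.
elim=> [|n IH].
  rewrite (_ : (fun O => _) = cst 0); first exact: cm_cst.
  by apply/funext => O; rewrite /series/= big_geq.
rewrite (_ : (fun O => _) = (fun O => series (exp_coeff (phi O)) n)
   \+ ((n`!%:R)^-1 \*o (fun O => phi O ^+ n))).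
  by apply: cmD => //; apply: cmZ => //; rewrite invr_ge0.
apply/funext => O.
by rewrite /series/= big_nat_recr//= /exp_coeff/= [_ / _]mulrC.
Qed.

End complete_monotonicity.

Section void_probabilities.
Variables (R : realType) (d : measure_display) (Y : measurableType d).
Variables (m : {measure set Y -> \bar R}) (A : nat -> set Y).
Hypothesis mA : forall i, measurable (A i).
Hypothesis fA : forall i, (m (A i) < +oo)%E.
Implicit Types (U : set Y) (O : set nat).

Definition hit O := \bigcup_(i in O) A i.

Definition void_prob O : R := expR (- fine (m (hit O))).

Lemma measurable_hit O : measurable (hit O).
Proof. by apply: bigcup_measurable => i _; exact: mA. Qed.

Lemma hitU1 i O : hit (i |` O) = A i `|` hit O.
Proof. by rewrite /hit bigcup_setU bigcup_set1. Qed.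

Lemma hit_fin O : finite_set O -> (m (hit O) < +oo)%E.
Proof.
move=> /finite_seqP[s ->]; elim: s => [|i s IH].
  by rewrite /hit set_nil bigcup_set0 measure0.
have -> : [set` i :: s] = i |` [set` s].
  apply/seteqP; split => x /=; rewrite inE.
    by move=> /predU1P.
  by move=> h; apply/predU1P.
rewrite hitU1; apply: le_lt_trans (measureU2 _ (mA i) (measurable_hit _)) _.
by apply: lte_add_pinfty; [exact: fA|exact: IH].
Qed.

(** The alternating difference is itself a measure, that of the points of U
    lying in every set of C and in no set of O: adding c to C amounts to
    replacing U by its intersection with A c. *)
Lemma cm_avoid U : measurable U -> (m U < +oo)%E ->
  completely_monotone (fun O => fine (m (U `\` hit O))).
Proof.
move=> mU fU C O.
have fin V B : measurable V -> (m V < +oo)%E -> measurable B ->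
    m (V `\` B) \is a fin_num.
  move=> mV fV mB; rewrite ge0_fin_numE//; apply: le_lt_trans fV.
  by apply: le_measure; rewrite ?inE//; exact: measurableD.
elim: C U mU fU O => [|c C IH] U mU fU O; first exact: fine_ge0.
rewrite alt_diff_cons.
rewrite (_ : _ \- _ = fun O => fine (m ((U `&` A c) `\` hit O))).
  apply: IH; first exact: measurableI.
  apply: le_lt_trans fU; apply: le_measure; rewrite ?inE//.
  exact: measurableI.
apply/funext => O' /=; rewrite hitU1 [in X in X - _](_ : U `\` hit O' =
    (U `\` (A c `|` hit O')) `|` ((U `&` A c) `\` hit O')); last first.
  apply/seteqP; split => x /=; last by tauto.
  by have := pselect (A c x); tauto.
rewrite measureU//.
- rewrite fineD//; first by rewrite addrAC subrr add0r.
    by apply: fin => //; apply: measurableU => //; exact: measurable_hit.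
  apply: fin; [exact: measurableI| |exact: measurable_hit].
  apply: le_lt_trans fU; apply: le_measure; rewrite ?inE//.
  exact: measurableI.
- by apply: measurableD => //; apply: measurableU => //; exact: measurable_hit.
- by apply: measurableD; [exact: measurableI|exact: measurable_hit].
- by apply/seteqP; split => x //=; tauto.
Qed.

(** Inside a set W of finite measure that contains all the sets involved,
    exp(- m(hit O)) = exp(- m(W)) exp(m(W \ hit O)), and the exponential series
    preserves complete monotonicity. *)
Lemma alt_diff_void_prob_ge0 C O : finite_set O -> 0 <= alt_diff void_prob C O.
Proof.
move=> finO; pose W := O `|` [set` C].
have finW : finite_set W by rewrite finite_setU.
have mW := measurable_hit W.
rewrite (@alt_diff_local _ _ _ (expR (- fine (m (hit W))) \*o
  (expR \o (fun O => fine (m (hit W `\` hit O)))))).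
  rewrite alt_diffZ mulr_ge0 ?expR_ge0//; apply: cm_expR; apply: cm_avoid => //.
  exact: hit_fin.
move=> O' _ O'W /=; rewrite /void_prob -expRD; congr expR.
have O'W' : hit O' `<=` hit W by exact: bigcup_subset.
have fO' : m (hit O') \is a fin_num.
  by rewrite ge0_fin_numE//; apply: hit_fin; exact: sub_finite_set finW.
have fWO' : m (hit W `\` hit O') \is a fin_num.
  rewrite ge0_fin_numE//; apply: le_lt_trans (hit_fin finW).
  apply: le_measure; rewrite ?inE//; apply: measurableD => //.
  exact: measurable_hit.
rewrite -{1}(setDUK O'W') measureU//.
- by rewrite fineD// opprD addrNK.
- exact: measurable_hit.
- by apply: measurableD => //; exact: measurable_hit.
- by rewrite setDIK.
Qed.

End void_probabilities.

(** * Events on the unit interval with prescribed intersections *)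

Section unit_interval.
Variable R : realType.

Definition unit_lebesgue : set (measurableTypeR R) -> \bar R :=
  mrestr lebesgue_measure (measurable_itv `[0%R, 1%R[ : measurable _).

HB.instance Definition _ := Measure.on unit_lebesgue.

Let unit_lebesgueT : unit_lebesgue setT = 1%:E.
Proof.
rewrite /unit_lebesgue /mrestr setTI lebesgue_measure_itv/=.
by rewrite lte_fin ltr01 oppr0 adde0.
Qed.

HB.instance Definition _ :=
  @Measure_isProbability.Build _ _ R unit_lebesgue unit_lebesgueT.

End unit_interval.

Section binary_process.
Variables (R : realType) (phi : set nat -> R).
Hypothesis phi0 : phi set0 = 1.
Hypothesis phi_ge0 : forall C O, finite_set O -> 0 <= alt_diff phi C O.
Implicit Types (s : seq bool) (x : R) (F : set nat).

(** A history s lists the first outcomes with the latest one at the head, so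
    that the head of b :: s belongs to the index size s. *)
Fixpoint open_indices s : set nat :=
  if s is b :: s' then
    if b then size s' |` open_indices s' else open_indices s' else set0.

Fixpoint closed_indices s : seq nat :=
  if s is b :: s' then
    if b then closed_indices s' else size s' :: closed_indices s' else [::].

Definition weight s : R := alt_diff phi (closed_indices s) (open_indices s).

Lemma finite_open_indices s : finite_set (open_indices s).
Proof.
elim: s => [|[] s IH] //=.
by rewrite finite_setU; split => //; exact: finite_set1.
Qed.

Lemma weight_ge0 s : 0 <= weight s.
Proof. exact/phi_ge0/finite_open_indices. Qed.

(** Consistency of the prescribed distributions, which holds by definition of
    the alternating differences. *)
Lemma weight_split s : weight (true :: s) + weight (false :: s) = weight s.
Proof. by rewrite /weight/= addrC subrK. Qed.

(** The cell of s has length weight s, and the cells of its two extensions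
    partition it, the cell of true :: s being on the left. *)
Fixpoint left_end s : R :=
  if s is b :: s' then
    if b then left_end s' else left_end s' + weight (true :: s') else 0.

Definition cell s : set R := `[left_end s, left_end s + weight s[%classic.

Lemma cell_split s : cell s = cell (true :: s) `|` cell (false :: s).
Proof.
have := weight_ge0 (true :: s); have := weight_ge0 (false :: s).
have := weight_split s; rewrite /cell /= => ? ? ?.
apply/seteqP; split => x /=; rewrite !in_itv/=; last first.
  by move=> [/andP[? ?]|/andP[? ?]]; apply/andP; split; lra.
move=> /andP[? ?]; have [?|?] := ltP x (left_end s + weight (true :: s)).
  by left; apply/andP; split; lra.
by right; apply/andP; split; lra.
Qed.

Lemma cell_disjoint s : cell (true :: s) `&` cell (false :: s) = set0.
Proof.
apply/seteqP; split => x //=; rewrite /cell/= !in_itv/=.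
by move=> [/andP[_ ?] /andP[? _]]; lra.
Qed.

Fixpoint history n x : seq bool :=
  if n is n'.+1 then
    let h := history n' x in (x < left_end h + weight (true :: h)) :: h
  else [::].

Definition bit n : set R := [set x | head true (history n.+1 x)].

Lemma size_history n x : size (history n x) = n.
Proof. by elim: n => //= n ->. Qed.

Lemma cell_sub b s : cell (b :: s) `<=` cell s.
Proof. by move=> x; rewrite [cell s]cell_split; case: b; [left|right]. Qed.

Lemma cell_sub_nil s : cell s `<=` cell [::].
Proof. by elim: s => // b s IH x /cell_sub /IH. Qed.

Lemma cell_nil : cell [::] = `[0, 1[%classic.
Proof. by rewrite /cell /weight/= phi0 add0r. Qed.

Lemma cell_history_cons x s b : cell s x ->
  cell (b :: s) x -> b = (x < left_end s + weight (true :: s)).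
Proof.
case: b; rewrite /cell/= !in_itv/= => _ /andP[] //.
by move=> h _; apply/esym/negP/negP; rewrite -leNgt.
Qed.

Lemma cell_historyP n x s : size s = n -> cell [::] x ->
  cell s x <-> history n x = s.
Proof.
move=> + x01; elim: n s => [[]//|n IH [//|b s] /= [sn]].
split => [bs|[<- hs]].
  have hs := (IH _ sn).1 (cell_sub bs).
  by rewrite hs -(cell_history_cons (cell_sub bs) bs).
have : cell s x by apply/IH.
rewrite hs [cell s]cell_split /cell => -[]; rewrite /= !in_itv/= => /andP[].
  by move=> h1 h2; rewrite h2 h1.
by move=> h1 h2; rewrite ltNge h1/= h1 h2.
Qed.

Lemma bit_cell s x : cell s x -> bit (size s) x <-> cell (true :: s) x.
Proof.
move=> sx; have x01 := cell_sub_nil sx.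
have hs : history (size s) x = s by apply/cell_historyP.
by rewrite /bit/= hs; move: sx; rewrite /cell/= !in_itv/= => /andP[-> _].
Qed.

(** A countable union of cells: all s of length n followed by true. *)
Lemma measurable_bit n : measurable (bit n `&` cell [::]).
Proof.
have -> : bit n `&` cell [::] =
    \bigcup_(s : seq bool) (if size s == n then cell (true :: s) else set0).
  apply/seteqP; split => x /=.
    move=> [bx x01]; exists (history n x) => //; rewrite size_history eqxx.
    apply/bit_cell; rewrite ?size_history//.
    by apply/(cell_historyP _ x01); rewrite ?size_history.
  move=> [s _]; case: eqP => [sn ts|//].
  split; last exact: cell_sub_nil ts.
  by rewrite -sn; apply/(bit_cell (cell_sub ts)).
apply: countable_bigcupT_measurable => // s; case: eqP => // _.
exact: measurable_itv.
Qed.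

(** Conditions on the indices of F among the j ones that follow the history
    s. Keeping the whole past s fixed lets the probability be computed by
    induction on j: an index in F is forced to be open, and an index outside F
    is summed out, which undoes one alternating difference. *)
Definition later_open F s j : set R :=
  cell s `&` [set x | forall i, F i -> (size s <= i < size s + j)%N -> bit i x].

Lemma cell_measure s : lebesgue_measure (cell s) = (weight s)%:E.
Proof.
rewrite /cell lebesgue_measure_itv/= lte_fin ltrDl.
have := weight_ge0 s; rewrite le_eqVlt => /predU1P[<-|->].
  by rewrite ltxx.
by rewrite -EFinD addrAC subrr add0r.
Qed.

Lemma measurable_later_open F s j : measurable (later_open F s j).
Proof.
rewrite (_ : later_open F s j = cell s `&`
  \bigcap_(i in [set i | F i /\ (size s <= i < size s + j)%N])
    (bit i `&` cell [::])).
  apply: measurableI; first exact: measurable_itv.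
  by apply: bigcap_measurableType => i _; exact: measurable_bit.
apply/seteqP; split => x [sx h]; split => // i.
  by move=> [Fi ij]; split; [exact: h|exact: cell_sub_nil sx].
by move=> Fi ij; have [] := h i (conj Fi ij).
Qed.

Lemma later_open_measure F s j :
  lebesgue_measure (later_open F s j) =
  (alt_diff phi (closed_indices s)
    (open_indices s `|` (F `&` [set i | (size s <= i < size s + j)%N])))%:E.
Proof.
elim: j s => [|j IH] s.
  rewrite (_ : later_open _ _ _ = cell s); last first.
    apply/seteqP; split => [x []|x sx] //; split => // i _.
    by rewrite addn0; lia.
  rewrite cell_measure; congr (alt_diff _ _ _)%:E.
  apply/seteqP; split => [x|x]; first by left.
  by move=> [//|[_ /= ?]]; exfalso; lia.
have later_cons b : later_open F (b :: s) j = cell (b :: s) `&`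
    [set x | forall i, F i -> (size s < i < size s + j.+1)%N -> bit i x].
  apply/seteqP; split => x /= [bs h]; split => // i Fi /= ij.
    by apply: h => //=; lia.
  by apply: h => //=; lia.
have [Fs|nFs] := pselect (F (size s)).
  have -> : later_open F s j.+1 = later_open F (true :: s) j.
    rewrite later_cons; apply/seteqP; split => x /= [sx h].
      split; last by move=> i Fi ij; apply: h => //; lia.
      by apply/(bit_cell sx); apply: h => //; lia.
    split; first exact: cell_sub sx.
    move=> i Fi; rewrite leq_eqVlt => /andP[/predU1P[<- _|si ij]].
      by apply/(bit_cell (cell_sub sx)).
    by apply: h => //; lia.
  rewrite IH/=; congr (alt_diff _ _ _)%:E.
  apply/seteqP; split => i /=.
    move=> [[->|]|[Fi ij]]; [right|left|right] => //; split => //; lia.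
  move=> [|[Fi]]; first by left; right.
  rewrite leq_eqVlt => /andP[/predU1P[<- _|si ij]]; first by left; left.
  by right; split => //; lia.
have -> : later_open F s j.+1 =
    later_open F (true :: s) j `|` later_open F (false :: s) j.
  rewrite !later_cons -setIUl -cell_split.
  apply/seteqP; split => x /= [sx h]; split => // i Fi ij.
    by apply: h => //; lia.
  apply: h => //.
  suff : i <> size s by lia.
  by move=> is_; apply: nFs; rewrite -is_.
rewrite measureU; [|exact: measurable_later_open..|]; last first.
  apply/seteqP; split => // x [[ts _] [fs _]].
  by rewrite -(cell_disjoint s).
apply: etrans (congr2 +%E (IH (true :: s)) (IH (false :: s))) _.
rewrite -EFinD /=; congr (_%:E).
set F' := F `&` [set i | (size s < i < (size s).+1 + j)%N].
have -> : F `&` [set i | (size s <= i < size s + j.+1)%N] = F'.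
  apply/seteqP; split => i -[Fi /= ij]; split => //=; last lia.
  suff : i <> size s by lia.
  by move=> is_; apply: nFs; rewrite -is_.
by rewrite setUA addrC subrK.
Qed.

Definition bit_event n : set (measurableTypeR R) := bit n `&` cell [::].

(** The case of the empty history, with j large enough to exceed all
    indices of F. *)
Lemma bit_event_prob F : finite_set F ->
  unit_lebesgue (\bigcap_(i in F) bit_event i) = (phi F)%:E.
Proof.
move=> finF.
have [n Fn] : exists n, F `<=` `I_n.
  have /finite_seqP[t ->] := finF.
  by exists (\max_(i <- t) i).+1 => i /= it; rewrite ltnS (leq_bigmax_seq i).
have := later_open_measure F [::] n.
rewrite /= set0U (_ : F `&` _ = F); last first.
  by apply/seteqP; split => [i []|i Fi]//; split => //=; exact: Fn.
move <-; rewrite /unit_lebesgue /mrestr -cell_nil; congr (lebesgue_measure _).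
apply/seteqP; split => x /=.
  by move=> [h x01]; split => // i Fi _; have [] := h i Fi.
move=> [x01 h]; split => // i Fi; split => //; apply: h => //=.
exact: Fn.
Qed.

End binary_process.

(** * Measurability of bond configurations *)

Section configurations.
Variables (V : Type) (E : set (set V)).
Implicit Types (w : bond_config E).

(** A product topology restricts finitely many coordinates, hence only
    coordinates of rank below some n for any ranking c of the edges. *)
Lemma cylinder_nhds (c : E -> nat) (U : set (bond_config E)) w :
  @open {ptws E -> bool} U -> U w ->
  exists n, forall w', (forall e, (c e < n)%N -> w' e = w e) -> U w'.
Proof.
move=> oU Uw.
pose base n : set {ptws E -> bool} :=
  [set w' | forall e, (c e < n)%N -> w' e = w e].
pose F := filter_from setT base.
have FF : Filter F.
  apply: filter_from_filter; first by exists 0%N.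
  move=> i j _ _; exists (maxn i j) => // w' h.
  by split => e ce; apply: h; rewrite leq_max ce ?orbT.
have Fw : F --> (w : {ptws E -> bool}).
  apply/cvg_sup => e; rewrite cvg_image; last first.
    by rewrite eqEsubset; split=> v // _; exists (cst v).
  move=> W Ww; exists (@^~ e @^-1` W).
    exists (c e).+1 => // w' h.
    by rewrite /preimage/= h//; exact: nbhs_singleton Ww.
  by rewrite image_preimage // eqEsubset; split=> // j _; exists (fun _ => j).
have [n _ nU] : F U by apply: Fw; exact: open_nbhs_nbhs.
by exists n => w' h; apply: nU.
Qed.

(** The Borel sigma-algebra is generated by open sets. With countably many
    edges an open set is a union of cylinders, and there are countably many
    cylinders since each is given by a bit string indexed by edge ranks. *)
Lemma measurable_config_map d (T : measurableType d) (c : E -> nat)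
    (W : T -> bond_config E) : injective c ->
  (forall e, measurable [set x | W x e]) -> measurable_fun setT W.
Proof.
move=> injc mW.
have := @measurability _ _ T (g_sigma_algebraType (@open {ptws E -> bool}))
  setT W (@open {ptws E -> bool}) erefl.
apply; move=> _ [U oU <-]; rewrite setTI.
pose cyl (s : seq bool) : set (bond_config E) :=
  [set w | forall e, (c e < size s)%N -> w e = nth false s (c e)].
have -> : W @^-1` U =
    \bigcup_(s in [set s | cyl s `<=` U]) (W @^-1` (cyl s)).
  apply/seteqP; split => x /=; last by move=> [s sU /sU].
  move=> UWx; have [n nU] := cylinder_nhds c oU UWx.
  pose b i : bool := `[< exists2 e : E, c e = i & W x e >].
  have bE e : W x e = b (c e).
    apply/idP/asboolP; first by exists e.
    by move=> [e' /injc ->].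
  exists (mkseq b n).
    move=> w /= ws; apply: nU => e ce; rewrite ws ?size_mkseq//.
    by rewrite nth_mkseq// bE.
  by move=> e; rewrite size_mkseq => ce; rewrite nth_mkseq// bE.
rewrite bigcup_mkcond; apply: countable_bigcupT_measurable => // s.
case: ifP => // _.
have -> : W @^-1` cyl s = \bigcap_(i in [set i | (i < size s)%N])
    \bigcap_(e in [set e | c e = i]) [set x | W x e = nth false s i].
  apply/seteqP; split => x /=; first by move=> h i ilt e /= ei; rewrite h ?ei.
  by move=> h e ce; exact: h.
apply: bigcap_measurableType => i _.
have [[e ei]|ne] := pselect (exists e, c e = i); last first.
  rewrite (_ : \bigcap_(e in _) _ = setT)//.
  by apply/seteqP; split => // x _ e ei; case: ne; exists e.
rewrite (_ : [set e | c e = i] = [set e]); last first.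
  by apply/seteqP; split => [e' /= e'i|_ /= ->//]; apply: injc; rewrite ei.
rewrite bigcap_set1; case: (nth false s i); first exact: mW.
rewrite (_ : [set x | _] = ~` [set x | W x e]).
  by apply: measurableC; exact: mW.
by apply/seteqP; split => x /=; [move=> ->|move/negP/negbTE].
Qed.

Lemma measurable_open_edge (e : E) : measurable [set w : bond_config E | w e].
Proof.
apply: sub_sigma_algebra.
have -> : [set w : bond_config E | w e] =
    (@proj E (fun=> bool) e) @^-1` [set true].
  by apply/seteqP; split => w.
apply: open_comp; last exact: discrete_open.
by move=> w _; exact: proj_continuous.
Qed.

Lemma measurable_adjacent x y :
  measurable [set w : bond_config E | adjacent (open_edges w) x y].
Proof.
have [xyE|nE] := pselect (E [set x; y]).
  pose xy : E := SigSub (mem_set xyE).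
  have -> : [set w : bond_config E | adjacent (open_edges w) x y] =
      [set w | w xy].
    apply/seteqP; split => w /=.
      move=> /asboolP[e we exy]; move: we; congr (is_true (w _)).
      exact: val_inj.
    by move=> we; apply/asboolP; exists xy.
  exact: measurable_open_edge.
rewrite (_ : [set w | _] = set0)//; apply/seteqP; split => w //=.
by move=> /asboolP[[e eE] _ /= exy]; apply: nE; rewrite -exy; exact: set_mem eE.
Qed.

Lemma measurable_walk u v p :
  measurable [set w : bond_config E | is_walk (open_edges w) u v p].
Proof.
elim: p u => [|x p IH] u.
  have [->|uv] := pselect (u = v).
    by rewrite (_ : [set w | _] = setT)//; apply/seteqP; split.
  by rewrite (_ : [set w | _] = set0)//; apply/seteqP; split => w // -[].
rewrite (_ : [set w | _] = [set w | adjacent (open_edges w) u x]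
   `&` [set w | is_walk (open_edges w) x v p]).
  by apply: measurableI => //; exact: measurable_adjacent.
apply/seteqP; split => w /=.
  by rewrite /is_walk/= => -[/andP[? ?] ?].
by rewrite /is_walk/= => -[-> [-> ->]].
Qed.

Lemma same_cluster_bigcup (en : nat -> V) (u v : V) :
  (forall x, exists n, en n = x) ->
  [set w : bond_config E | same_cluster (open_edges w) u v] =
  \bigcup_(q : seq nat) [set w | is_walk (open_edges w) u v (map en q)].
Proof.
move=> /choice[c cK]; apply/seteqP; split => w /= [p].
  move=> uv; exists (map c p) => //.
  by rewrite -map_comp (eq_map (_ : en \o c =1 id)) ?map_id//.
by move=> _ uv; exists (map en p).
Qed.

Lemma measurable_same_cluster (en : nat -> V) (u v : V) :
  (forall x, exists n, en n = x) ->
  measurable [set w : bond_config E | same_cluster (open_edges w) u v].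
Proof.
move=> enP; rewrite (same_cluster_bigcup u v enP).
by apply: countable_bigcupT_measurable => // q; exact: measurable_walk.
Qed.

End configurations.

(** * Percolation by random cuts *)

Section cut_percolation.
Variables (R : realType) (V : Type) (E : set (set V)) (en : nat -> V).
Hypothesis enP : forall x, exists n, en n = x.
Hypothesis EP : forall e, E e -> exists x y, e = [set x; y].
Variables (d : measure_display) (Y : measurableType d).
Variables (m : {measure set Y -> \bar R}) (A : V -> set Y).
Hypothesis mA : forall u, measurable (A u).
Hypothesis fA : forall u v, (m (A u `+` A v) < +oo)%E.

Let sep u v : R := fine (m (A u `+` A v)).

Let pair_cut (n : nat) : set Y :=
  if @choice.unpickle (nat * nat)%type n is Some (i, j)
  then A (en i) `+` A (en j) else set0.

Let pair_cutP u v : exists n, pair_cut n = A u `+` A v.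
Proof.
have [[i <-] [j <-]] := (enP u, enP v).
by exists (choice.pickle (i, j)); rewrite /pair_cut choice.pickleK.
Qed.

Let measurable_pair_cut n : measurable (pair_cut n).
Proof.
rewrite /pair_cut; case: choice.unpickle => [[i j]|//].
exact: measurable_setY.
Qed.

Let pair_cut_fin n : (m (pair_cut n) < +oo)%E.
Proof.
by rewrite /pair_cut; case: choice.unpickle => [[i j]|]; rewrite ?measure0.
Qed.

Let phi := void_prob m pair_cut.

Let event n : set (measurableTypeR R) := bit_event phi n.

Let phi0 : phi set0 = 1.
Proof. by rewrite /phi /void_prob /hit bigcup_set0 measure0 oppr0 expR0. Qed.

Let phi_ge0 C O : finite_set O -> 0 <= alt_diff phi C O.
Proof. exact: alt_diff_void_prob_ge0. Qed.

Let event_prob F : finite_set F ->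
  unit_lebesgue (\bigcap_(i in F) event i) =
  (expR (- fine (m (\bigcup_(i in F) pair_cut i))))%:E.
Proof. exact: bit_event_prob. Qed.

Let measurable_event n : measurable (event n).
Proof. exact: measurable_bit. Qed.


(** The index depends on the cut alone and not on the pair (u, v): since
    A_u + A_v = A_v + A_u, an undirected edge then has a well-defined event,
    whichever way it is traversed. *)
Let index_of (B : set Y) : nat := xget 0%N [set n | pair_cut n = B].

Let index_ofP u v : pair_cut (index_of (A u `+` A v)) = A u `+` A v.
Proof.
rewrite /index_of; case: xgetP => [n _ //|/= H].
by have [n /H] := pair_cutP u v.
Qed.

Fixpoint walk_indices u (p : seq V) : set nat :=
  if p is x :: p' then index_of (A u `+` A x) |` walk_indices x p' else set0.

Lemma finite_walk_indices u p : finite_set (walk_indices u p).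
Proof. by elim: p u => //= x p IH u; rewrite finite_setU. Qed.

Lemma walk_cuts_cover u p :
  A u `+` A (last u p) `<=` \bigcup_(i in walk_indices u p) pair_cut i.
Proof.
elim: p u => [|x p IH] u /=; first by rewrite setYK.
rewrite bigcup_setU bigcup_set1 index_ofP.
by move=> y /(@setY_triangle _ _ (A x))[|/IH]; [left|right].
Qed.

Lemma walk_cuts_measure L u v p : is_walk E u v p ->
  (forall x y, E [set x; y] -> sep x y <= L) ->
  (m (\bigcup_(i in walk_indices u p) pair_cut i) <= (L * (size p)%:R)%:E)%E.
Proof.
move=> + sepL; elim: p u => [|x p IH] u /=.
  by move=> _; rewrite bigcup_set0 measure0 mulr0.
rewrite /is_walk/= => -[/andP[/asboolP ux xp] pv].
rewrite bigcup_setU bigcup_set1 index_ofP.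
apply: le_trans (measureU2 _ _ _) _.
- exact: measurable_setY.
- by apply: bigcup_measurable => i _; exact: measurable_pair_cut.
rewrite -natr1 mulrDr mulr1 addrC EFinD leeD//.
  exact: (IH x (conj xp pv)).
have := sepL _ _ ux; rewrite /sep -lee_fin fineK//.
by rewrite ge0_fin_numE.
Qed.

Let config (x : measurableTypeR R) : bond_config E :=
  fun e => `[< exists u v,
    set_val e = [set u; v] /\ event (index_of (A u `+` A v)) x >].

Let config_edge (e : E) u v x : set_val e = [set u; v] ->
  config x e = `[< event (index_of (A u `+` A v)) x >].
Proof.
move=> euv; apply/asboolP/asboolP => [[u' [v' [+ ev]]]|ev]; last by exists u, v.
by rewrite euv => uvE; have [[-> ->]//|[-> ->]] := set2_eq uvE; rewrite setYC.
Qed.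

Let config_adjacent u v x : adjacent (open_edges (config x)) u v <->
  E [set u; v] /\ event (index_of (A u `+` A v)) x.
Proof.
split => [/asboolP[e + euv]|[uvE ev]].
  rewrite /= (config_edge _ euv) => /asboolP ev; split => //; rewrite -euv.
  by case: e {euv} => e eE /=; exact: set_mem.
apply/asboolP; exists (SigSub (mem_set uvE)) => //=.
by rewrite (@config_edge _ u v)//; exact/asboolP.
Qed.

Let config_walk u v p x : is_walk (open_edges (config x)) u v p ->
  (\bigcap_(i in walk_indices u p) event i) x.
Proof.
elim: p u => [|y p IH] u; first by move=> _ i.
rewrite /is_walk/= => -[/andP[/config_adjacent[_ uy] yp] pv].
by move=> i [->//|]; apply: IH.
Qed.

Let walk_config u v p x : is_walk E u v p ->
  (\bigcap_(i in walk_indices u p) event i) x ->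
  is_walk (open_edges (config x)) u v p.
Proof.
elim: p u => [//|y p IH] u.
rewrite /is_walk/= => -[/andP[/asboolP uy yp] pv] ev.
have [] := IH y (conj yp pv); first by move=> i yi; apply: ev; right.
move=> -> ->; split => //; rewrite andbT; apply/config_adjacent.
by split => //; apply: ev; left.
Qed.

Let measurable_config : measurable_fun setT config.
Proof.
have /choice[ends endsP] : forall e : E,
    exists uv : V * V, set_val e = [set uv.1; uv.2].
  by case=> e eE; have [x [y exy]] := EP (set_mem eE); exists (x, y).
have /choice[rank rankP] := enP.
apply: (@measurable_config_map _ _ _ _
  (fun e => choice.pickle (rank (ends e).1, rank (ends e).2))).
  move=> e f /(pcan_inj (@choice.pickleK _)) [h1 h2].
  apply: val_inj; rewrite [LHS]endsP [RHS]endsP.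
  by rewrite -(rankP (ends e).1) -(rankP (ends e).2) h1 h2 !rankP.
move=> e; rewrite (_ : [set x | _] =
    event (index_of (A (ends e).1 `+` A (ends e).2))).
  exact: measurable_event.
by apply/seteqP; split => x /=; rewrite (config_edge _ (endsP e)) => /asboolP.
Qed.

(** Adding the cut A_u + A_v to those of the steps of the walk does not
    enlarge their union, so it does not change the probability that all of
    them are void. *)
Let negligible_walk u v p : last u p = v ->
  unit_lebesgue ((\bigcap_(i in walk_indices u p) event i) `\`
    event (index_of (A u `+` A v))) = 0%E.
Proof.
move=> pv; set B := \bigcap_(i in _) _; set C := event _.
have mB : measurable B.
  by apply: bigcap_measurableType => i _; exact: measurable_event.
have mC : measurable C by exact: measurable_event.
rewrite measureD//; last by rewrite (le_lt_trans (probability_le1 _ _))// ltry.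
have -> : B `&` C =
    \bigcap_(i in index_of (A u `+` A v) |` walk_indices u p) event i.
  by rewrite bigcap_setU bigcap_set1 setIC.
have finB := finite_walk_indices u p.
have finBC : finite_set (index_of (A u `+` A v) |` walk_indices u p).
  by rewrite finite_setU.
apply: etrans
  (congr2 (fun a b => a - b)%E (event_prob finB) (event_prob finBC)) _.
rewrite bigcup_setU bigcup_set1 index_ofP -[in A v]pv.
by rewrite setUidr ?subee//; exact: walk_cuts_cover.
Qed.

(** The three bounds come from single cuts, from the negligible sets above
    for the countably many walks from u to v, and from the subadditivity of m
    along one walk in E. *)
Lemma cut_percolation : exists P : bond_percolation R E,
  [/\ forall (e : E) x y, set_val e = [set x; y] ->
        P [set w : bond_config E | w e] = (expR (- sep x y))%:E,
      forall u v,
        (P [set w : bond_config E | same_cluster (open_edges w) u v]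
          <= (expR (- sep u v))%:E)%E
    & forall L u v p, is_walk E u v p ->
        (forall x y, E [set x; y] -> sep x y <= L) ->
        ((expR (- (L * (size p)%:R)))%:E <=
          P [set w : bond_config E | same_cluster (open_edges w) u v])%E].
Proof.
pose X : {mfun measurableTypeR R >-> bond_config E} :=
  HB.pack_for {mfun measurableTypeR R >-> bond_config E} config
    (isMeasurableFun.Build _ _ _ _ _ measurable_config).
have ev_prob u v :
    unit_lebesgue (event (index_of (A u `+` A v))) = (expR (- sep u v))%:E.
  have := event_prob (finite_set1 (index_of (A u `+` A v))).
  by rewrite bigcap_set1 bigcup_set1 index_ofP.
have mcl u v : measurable [set x | same_cluster (open_edges (config x)) u v].
  have := measurable_config measurableT
    (measurable_same_cluster (E := E) u v enP).
  by rewrite setTI.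
have unit_lebesgue0 : @unit_lebesgue R set0 = 0%E by apply: measure0.
pose U : probability (measurableTypeR R) R := @unit_lebesgue R.
exists (distribution U X); split.
- move=> e x y exy; rewrite -ev_prob /distribution/= /pushforward.
  congr (unit_lebesgue _); apply/seteqP; split => z /=; 
    by rewrite /preimage/= (config_edge _ exy) => /asboolP.
- move=> u v; rewrite /distribution/= /pushforward -ev_prob.
  set S := [set x | same_cluster (open_edges (config x)) u v].
  set C := event _.
  have mC : measurable C by exact: measurable_event.
  rewrite -[leLHS]/(unit_lebesgue S).
  rewrite (measureDI _ (mcl u v) mC) [X in (X + _)%E](_ : _ = 0%E) ?add0e.
    by apply: le_measure; rewrite ?inE//; apply: measurableI => //; exact: mcl.
  apply/negligibleP; first by apply: measurableD => //; exact: mcl.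
  have [dec decP] : exists dec : nat -> seq nat, forall q, exists k, dec k = q.
    exists (fun k => odflt [::] (@choice.unpickle (seq nat) k)) => q.
    by exists (choice.pickle q); rewrite choice.pickleK.
  have : (@unit_lebesgue R).-negligible (\bigcup_k
      ([set x | is_walk (open_edges (config x)) u v (map en (dec k))] `\` C)).
    apply: negligible_bigcup => k.
    have [uv|nuv] := pselect (last u (map en (dec k)) = v); last first.
      exists set0; split; [exact: measurable0|exact: unit_lebesgue0|].
      by move=> x [[_ /nuv]].
    exists (\bigcap_(i in walk_indices u (map en (dec k))) event i `\` C).
    split.
    - apply: measurableD => //; apply: bigcap_measurableType => i _.
      exact: measurable_event.
    - exact: negligible_walk.
    - by apply: setSD => x; exact: config_walk.
  apply: negligibleS => x [[p uv] nCx].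
  have /choice[rank rankP] := enP.
  have [k kp] := decP (map rank p); exists k => //; split => //=.
  by rewrite kp -map_comp (eq_map (_ : en \o rank =1 id)) ?map_id.
- move=> L u v p uvp sepL.
  rewrite /distribution/= /pushforward.
  apply: (@le_trans _ _
    (unit_lebesgue (\bigcap_(i in walk_indices u p) event i))).
    rewrite event_prob; last exact: finite_walk_indices.
    rewrite lee_fin ler_expR lerN2 -lee_fin fineK.
      exact: walk_cuts_measure uvp sepL.
    rewrite ge0_fin_numE//; apply: (le_lt_trans (walk_cuts_measure uvp sepL)).
    exact: ltry.
  apply: le_measure; rewrite ?inE.
  - by apply: bigcap_measurableType => i _; exact: measurable_event.
  - exact: mcl.
  - by move=> x /(walk_config uvp) xp; exists p.
Qed.

End cut_percolation.

(** * Cut metrics from percolation clusters *)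

Lemma direct_sum_measure (R : realType) d (Z : measurableType d)
    (mu : nat -> {measure set Z -> \bar R}) (r : nat -> {nonneg R}) :
  exists m : {measure set (nat * Z)%type -> \bar R},
    forall A, m A = (\sum_(0 <= n <oo) (r n)%:num%:E * mu n (xsection A n))%E.
Proof.
have /choice[incl inclE] n : exists m : {measure set (nat * Z)%type -> \bar R},
    forall A, m A = mu n (xsection A n).
  unshelve refine (ex_intro _
    (pushforward (mu n) (pair n) : {measure set _ -> \bar R}) _).
    exact: measurable_pair1.
  move=> A; congr (mu n _).
  by apply/seteqP; split => z; rewrite /xsection/= inE.
exists (mseries (fun n => mscale (r n) (incl n)) 0).
by move=> A; apply: eq_eseriesr => n _; congr (_ * _)%E; exact: inclE.
Qed.

(** Sigma-finiteness makes the counting measure of the slices of a measurable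
    set a measurable function, as the product measure below requires. *)
HB.instance Definition _ (R : realType) :=
  @Measure_isSigmaFinite.Build _ _ _ (@counting nat R)
    (sigma_finite_counting R).

Section cluster_labels.
Variables (R : realType) (V : Type) (E : set (set V)) (en : nat -> V).
Hypothesis enP : forall x, exists n, en n = x.
Variable P : bond_percolation R E.

Definition cluster_label (w : bond_config E) (u : V) (k : nat) : Prop :=
  same_cluster (open_edges w) u (en k) /\
  forall j, (j < k)%N -> ~ same_cluster (open_edges w) u (en j).

Definition labelled u : set (bond_config E * nat) :=
  [set z | cluster_label z.1 u z.2].

Lemma cluster_label_exists w u : exists k, cluster_label w u k.
Proof.
have ex : exists k, `[< same_cluster (open_edges w) u (en k) >].
  have [k ku] := enP u; exists k; apply/asboolP; rewrite ku.
  exact: same_cluster_refl.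
exists (ex_minn ex); case: ex_minnP => k /asboolP uk kmin; split => // j.
by rewrite ltnNge => /negP jk uj; apply: jk; apply: kmin; exact/asboolP.
Qed.

Lemma cluster_label_uniq w u v k l : same_cluster (open_edges w) u v ->
  cluster_label w u k -> cluster_label w v l -> k = l.
Proof.
move=> uv [uk kmin] [vl lmin]; apply/eqP; rewrite eqn_leq; apply/andP; split.
  rewrite leqNgt; apply/negP => /kmin; apply; exact: same_cluster_trans uv vl.
rewrite leqNgt; apply/negP => /lmin; apply.
exact: same_cluster_trans (same_cluster_sym uv) uk.
Qed.

Lemma measurable_labelled u : measurable (labelled u).
Proof.
have -> : labelled u = \bigcup_k ([set w | cluster_label w u k] `*` [set k]).
  apply/seteqP; split => -[w k] /=; first by move=> h; exists k.
  by move=> [l _ [/= h ->]].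
apply: bigcupT_measurable => k; apply: measurableX => //.
have -> : [set w | cluster_label w u k] =
    [set w : bond_config E | same_cluster (open_edges w) u (en k)] `&`
    \bigcap_(j in [set j | (j < k)%N])
      ~` [set w : bond_config E | same_cluster (open_edges w) u (en j)].
  by apply/seteqP; split.
apply: measurableI; first exact: measurable_same_cluster.
apply: bigcap_measurableType => j _; apply: measurableC.
exact: measurable_same_cluster.
Qed.

Lemma xsection_labelled w u k : cluster_label w u k ->
  xsection (labelled u) w = [set k].
Proof.
move=> uk; apply/seteqP; split => l; rewrite /xsection/= inE /labelled/=.
  by move=> ul; exact: cluster_label_uniq (same_cluster_refl _ _) ul uk.
by move=> ->.
Qed.

Lemma counting_pair (k l : nat) : k <> l ->
  (counting ([set k] `+` [set l]) = 2%:E :> \bar R)%E.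
Proof.
move=> kl; have -> : [set k] `+` [set l] = [set k] `|` [set l].
  apply/seteqP; split => x /=; first tauto.
  by move=> [->|->]; [left|right]; split => // /esym.
rewrite measureU//; last by apply/seteqP; split => // x /= [-> /kl].
have counting1 j : (@counting nat R [set j] = 1%:E)%E.
  by rewrite /counting asboolT ?fset_set1 ?cardfs1//; exact: finite_set1.
by apply: etrans (congr2 +%E (counting1 k) (counting1 l)) _; rewrite -EFinD.
Qed.

(** For fixed w, the slices of the two sets are singletons: they agree when u
    and v are connected in w, and otherwise their symmetric difference has two
    points. *)
Lemma labelled_setY u v :
  (P \x (@counting nat R))%E (labelled u `+` labelled v) =
  (2%:E * (1 - P [set w : bond_config E | same_cluster (open_edges w) u v]))%E.
Proof.
set C := [set w : bond_config E | _].
have mC : measurable C by exact: measurable_same_cluster.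
rewrite -probability_setC// /product_measure1/=.
transitivity (\int[P]_w (2%:E * (\1_(~` C) w)%:E))%E.
  apply: eq_integral => w _ /=.
  have [[k uk] [l vl]] := (cluster_label_exists w u, cluster_label_exists w v).
  rewrite [xsection _ _](_ : _ = [set k] `+` [set l]); last first.
    rewrite -(xsection_labelled uk) -(xsection_labelled vl).
    by apply/seteqP; split => j; rewrite /xsection/= !inE/=.
  have [Cw|nCw] := pselect (C w).
    have -> : k = l by exact: cluster_label_uniq Cw uk vl.
    by rewrite setYK measure0 indicE memNset ?mule0//=; apply.
  rewrite indicE mem_set//= mule1 counting_pair// => kl; apply: nCw.
  apply: same_cluster_trans uk.1 _; rewrite kl.
  exact/same_cluster_sym/vl.1.
rewrite ge0_integralZl//.
- by rewrite integral_indic ?setIT//; exact: measurableC.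
- by apply/measurable_EFinP; apply: measurable_indic; exact: measurableC.
Qed.

End cluster_labels.

Lemma nneseries_ge_term (R : realType) (f : nat -> \bar R) n :
  (forall i, 0 <= f i)%E -> (f n <= \sum_(0 <= i <oo) f i)%E.
Proof.
move=> f0; apply: le_trans (nneseries_lim_ge n.+1 (fun i _ _ => f0 i)).
by rewrite big_nat_recr//= leeDr// sume_ge0.
Qed.

Lemma expRN_le (R : realType) (y : R) :
  0 <= y <= 1 -> y <= 2 * (1 - expR (- y)).
Proof.
move=> /andP[y0 y1].
have y1p : 0 < 1 + y by lra.
have : expR (- y) <= (1 + y)^-1.
  by rewrite expRN lef_pV2 ?posrE ?expR_gt0// expR_ge1Dx.
have yV : (1 + y)^-1 * (1 + y) = 1 by rewrite mulVf// gt_eqF.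
have := mulr_ge0 y0 y0.
nra.
Qed.

Section mixture.
Variables (R : realType) (V : Type) (E : set (set V)) (en : nat -> V).
Hypothesis enP : forall x, exists n, en n = x.
Variables (dist : V -> V -> R) (a a' C : R).
Hypothesis dist_discrete : forall u v, dist u v = 0 \/ 1 <= dist u v.
Hypotheses (a'_ge0 : 0 <= a') (a'a : a' < a) (C0 : 0 < C).
Hypothesis perc : forall delta, 0 < delta ->
  exists (P : bond_percolation R E) (c : R),
    0 < c <= delta /\ forall u v,
      ((expR (- (C * c * dist u v)))%:E
         <= P [set w : bond_config E | same_cluster (open_edges w) u v])%E /\
      (P [set w : bond_config E | same_cluster (open_edges w) u v]
         <= (expR (- (c * dist_pow (dist u v) a)))%:E)%E.

Let t := (a - a') / a.

(* The scale c_n <= delta n is small enough that a distance d which is too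
   large for it, c_n d^a > 1, satisfies 2^(n+1) <= d^(a - a'); the first
   argument of the minimum makes c_n tend to 0. *)
Let delta n : R := Num.min (n.+1%:R^-1) ((2 ^+ n.+1) `^ t^-1)^-1.

Let a_gt0 : 0 < a. Proof. exact: le_lt_trans a'_ge0 a'a. Qed.

Let t_gt0 : 0 < t.
Proof. by rewrite divr_gt0 ?subr_gt0. Qed.

Let delta_gt0 n : 0 < delta n.
Proof. by rewrite lt_min !invr_gt0 powR_gt0 ?exprn_gt0// ltr0n. Qed.

Let scale_pow n c d : 0 < c <= delta n -> 1 <= d -> 1 < c * d `^ a ->
  2 ^+ n.+1 <= d `^ (a - a').
Proof.
move=> /andP[c0 cn] d1 cd.
have -> : d `^ (a - a') = (d `^ a) `^ t.
  by rewrite -powRrM /t mulrCA mulfV ?mulr1// gt_eqF.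
have -> : 2 ^+ n.+1 = ((2 ^+ n.+1) `^ t^-1) `^ t :> R.
  by rewrite -powRrM mulVf ?powRr1 ?exprn_ge0// gt_eqF.
apply: ge0_ler_powR; rewrite ?nnegrE ?powR_ge0//; first exact: ltW.
have : c <= ((2 ^+ n.+1) `^ t^-1)^-1.
  by apply: le_trans cn _; rewrite ge_min lexx orbT.
have K0 : 0 < (2 ^+ n.+1) `^ t^-1 :> R by rewrite powR_gt0 ?exprn_gt0.
rewrite -[leLHS]invrK lef_pV2 ?posrE ?invr_gt0// => cK.
have : c^-1 <= d `^ a by rewrite -[leLHS]mulr1 ler_pdivrMl// ltW.
by apply: le_trans; move: cK; rewrite -lef_pV2 ?posrE ?invr_gt0.
Qed.

(** Take the first scale with c_n d^a <= 1; the failure of the scale before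
    it bounds 2^n. *)
Let scale_exists (c : nat -> R) d : (forall n, 0 < c n <= delta n) -> 1 <= d ->
  exists n, c n * d `^ a <= 1 /\ d `^ a' <= 2 ^- n * d `^ a.
Proof.
move=> cd d1.
have ex : exists n, c n * d `^ a <= 1.
  exists (Num.bound (d `^ a)); have /andP[c0 cn] := cd (Num.bound (d `^ a)).
  have cb : c (Num.bound (d `^ a)) <= (Num.bound (d `^ a)).+1%:R^-1.
    by apply: le_trans cn _; rewrite ge_min lexx.
  apply: le_trans (ler_wpM2r (powR_ge0 _ _) cb) _.
  rewrite ler_pdivrMl ?ltr0n// mulr1.
  apply: le_trans (ltW (archi_boundP (powR_ge0 _ _))) _.
  by rewrite ler_nat.
exists (ex_minn ex); case: ex_minnP => n ncd nmin; split => //.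
(* For n = 0 it suffices that d >= 1. *)
have dE : d `^ a = d `^ (a - a') * d `^ a'.
  rewrite -powRD ?subrK//; apply/implyP => _.
  by rewrite gt_eqF// (lt_le_trans ltr01 d1).
case: n ncd nmin => [|n] ncd nmin.
  by rewrite expr0 invr1 mul1r; apply: ler_powR => //; exact: ltW.
have : 1 < c n * d `^ a.
  by rewrite ltNge; apply/negP => /nmin; rewrite ltnn.
move=> /(scale_pow (cd n) d1) h.
rewrite dE mulrA -[leLHS]mul1r ler_wpM2r ?powR_ge0//.
by rewrite -ler_pdivrMl ?invr_gt0 ?exprn_gt0// invrK mulr1.
Qed.

(** Scale n contributes the cut metric 2 (1 - tau_n) / c_n with weight
    2^-(n+1). Each of these is at most 2 C dist, so that the series is
    Lipschitz, and the term of [scale_exists] alone gives the lower bound. *)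
Lemma mixture_compressible : cut_compressible dist a'.
Proof.
have /choice[P /choice[c cP]] := fun n => perc (delta_gt0 n).
have c0 n : 0 < c n by have [/andP[]] := cP n.
have r0 n : 0 <= 2 ^- n.+1 / c n.
  by rewrite divr_ge0 ?invr_ge0 ?exprn_ge0// ltW.
pose M n := [the {measure set _ -> \bar R} of (P n \x (@counting nat R))%E].
have [m mE] := direct_sum_measure M (fun n => NngNum (r0 n)).
exists _, _, m, (fun u => snd @^-1` labelled (E := E) en u); split.
  move=> u; rewrite -[X in measurable X]setTI.
  by apply: measurable_snd => //; exact: measurable_labelled.
exists (2 * C), 2^-1; split; first by rewrite invr_gt0.
move=> u v; rewrite mE.
pose cl := [set w : bond_config E | same_cluster (open_edges w) u v].
pose tau n := fine (P n cl).
have tauK n : (tau n)%:E = P n cl.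
  by rewrite fineK// fin_num_measure//; exact: measurable_same_cluster.
have termE n : ((2 ^- n.+1 / c n)%:E * M n (xsection
   (snd @^-1` labelled (E := E) en u `+` snd @^-1` labelled (E := E) en v) n) =
   (2 ^- n.+1 / c n * (2 * (1 - tau n)))%:E)%E.
  rewrite (_ : xsection _ n = labelled en u `+` labelled en v); last first.
    by rewrite xsectionE.
  rewrite /M/= labelled_setY// -tauK.
  by rewrite [RHS]EFinM [X in _ = (_ * X)%E]EFinM EFinB.
have tau_le n : tau n <= expR (- (c n * dist_pow (dist u v) a)).
  by rewrite -lee_fin tauK; have [_ /(_ u v)[]] := cP n.
have tau_ge n : expR (- (C * c n * dist u v)) <= tau n.
  by rewrite -lee_fin tauK; have [_ /(_ u v)[]] := cP n.
have tau_le1 n : tau n <= 1.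
  by rewrite -lee_fin tauK probability_le1//; exact: measurable_same_cluster.
have term_ge0 n : 0 <= 2 ^- n.+1 / c n * (2 * (1 - tau n)).
  by rewrite mulr_ge0 ?r0// mulr_ge0// subr_ge0.
have -> : (\sum_(0 <= n <oo) (NngNum (r0 n))%:num%:E * M n (xsection
   (snd @^-1` labelled (E := E) en u `+` snd @^-1` labelled (E := E) en v) n) =
   \sum_(0 <= n <oo) (2 ^- n.+1 / c n * (2 * (1 - tau n)))%:E)%E.
  by apply: eq_eseriesr => n _; exact: termE.
split.
  have [d0|d1] := dist_discrete u v.
    rewrite /dist_pow d0 eqxx mulr0; apply: nneseries_ge0 => n _ _.
    by rewrite lee_fin.
  have d0 : 0 < dist u v := lt_le_trans ltr01 d1.
  have [n [cn dn]] := scale_exists (fun n => (cP n).1) d1.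
  apply: le_trans (nneseries_ge_term n _); last by move=> i; rewrite lee_fin.
  rewrite lee_fin /dist_pow gt_eqF//.
  have h : c n * dist u v `^ a <= 2 * (1 - tau n).
    apply: le_trans (expRN_le _) _.
      by rewrite cn mulr_ge0 ?powR_ge0// ltW.
    rewrite ler_pM2l// lerD2l lerN2; apply: le_trans (tau_le n) _.
    by rewrite /dist_pow gt_eqF.
  apply: le_trans (ler_wpM2l (r0 n) h).
  by rewrite mulrA mulfVK ?gt_eqF// exprS invfM -mulrA ler_pM2l ?invr_gt0.
apply: le_trans (lee_nneseries
  (v := fun n => (2 * C * dist u v / (2 ^ n.+1)%:R)%:E) _ _) _.
- by move=> n _ _; rewrite lee_fin.
- move=> n _; rewrite lee_fin natrX.
  have h : 1 - tau n <= C * c n * dist u v.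
    have := expR_ge1Dx (- (C * c n * dist u v)); have := tau_ge n; lra.
  have h2 : 2 * (1 - tau n) <= 2 * (C * c n * dist u v) by lra.
  apply: le_trans (ler_wpM2l (r0 n) h2) _.
  rewrite le_eqVlt; apply/orP; left; apply/eqP.
  by field; rewrite expf_neq0//= gt_eqF.
- apply: epsilon_trick0.
  have [->|d1] := dist_discrete u v; rewrite ?mulr0//.
  by rewrite mulr_ge0 ?mulr_ge0 ?(ltW C0)// (le_trans ler01 d1).
Qed.

End mixture.

(** * Compression and percolation for word metrics *)

Lemma dist_pow_le (R : realType) (K x y a : R) :
  1 <= K -> 0 <= a -> 0 <= x -> 0 <= y -> x <= K * y ->
  dist_pow x a <= K `^ a * dist_pow y a.
Proof.
move=> K1 a0 x0 y0 xy; rewrite /dist_pow; case: eqP => [_|/eqP xn].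
  by case: ifP => _; rewrite ?mulr0// mulr_ge0 ?powR_ge0.
case: eqP => [y_eq|_].
  by move: xy; rewrite y_eq mulr0 le_eqVlt (negbTE xn) ltNge x0.
rewrite -powRM ?(le_trans ler01 K1)//; apply: ge0_ler_powR; rewrite ?nnegrE//.
by rewrite mulr_ge0// (le_trans ler01 K1).
Qed.

Lemma cut_compressible_comparable (R : realType) (X : Type)
    (d1 d2 : X -> X -> R) (K a : R) :
  1 <= K -> 0 <= a -> (forall u v, 0 <= d1 u v) -> (forall u v, 0 <= d2 u v) ->
  (forall u v, d1 u v <= K * d2 u v) -> (forall u v, d2 u v <= K * d1 u v) ->
  cut_compressible d1 a -> cut_compressible d2 a.
Proof.
move=> K1 a0 d1_ge0 d2_ge0 d12 d21 [d [Z [m [A [mA [L [c [c0 mLc]]]]]]]].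
have K0 : 0 < K := lt_le_trans ltr01 K1.
exists d, Z, m, A; split => //; exists (`|L| * K), (c / K `^ a); split.
  by rewrite divr_gt0// powR_gt0.
move=> u v; have [mc mL] := mLc u v; split.
  apply: le_trans mc; rewrite lee_fin -mulrA ler_pM2l//.
  by rewrite ler_pdivrMl ?powR_gt0// dist_pow_le.
apply: le_trans mL _; rewrite lee_fin -mulrA.
apply: le_trans (ler_wpM2r (d1_ge0 u v) (ler_norm L)) _.
by rewrite ler_wpM2l.
Qed.

Section word_metric.
Variables (R : realType) (G : groupType).
Implicit Types S T : {fset G}.

Lemma word_dist_ge0 S u v : 0 <= word_dist R S u v.
Proof. exact: ler0n. Qed.

Lemma word_dist_eq0 S u v : sym_generating S -> word_dist R S u v = 0 -> u = v.
Proof.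
move=> gS /eqP; rewrite pnatr_eq0 => /eqP d0.
have [p [_ pv]] := graph_dist_walk (cayley_connected u v gS).
by rewrite d0 => /size0nil p0; rewrite -pv p0.
Qed.

Lemma word_dist_refl S u : word_dist R S u u = 0.
Proof.
apply/eqP; rewrite pnatr_eq0 -leqn0.
exact: (@graph_dist_le _ _ _ _ [::]).
Qed.

Lemma word_dist_edge S u v :
  cayley_edges S [set u; v] -> word_dist R S u v <= 1.
Proof.
move=> uv; rewrite /word_dist -[leRHS]/(1%:R) ler_nat.
apply: (@graph_dist_le _ _ _ _ [:: v]); split => //=.
by rewrite andbT; apply/asboolP.
Qed.

Lemma word_metric_comparable S T : sym_generating S -> sym_generating T ->
  exists K : R, 1 <= K /\
    forall u v, word_dist R S u v <= K * word_dist R T u v.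
Proof.
move=> gS gT; have [K KP] := word_metrics_comparable gS gT.
exists (K.+1)%:R; split; first by rewrite ler1n.
move=> u v; rewrite -natrM ler_nat; apply: leq_trans (KP u v) _.
by rewrite leq_mul2r leqnSn orbT.
Qed.

Lemma compressible_generators S T a :
  sym_generating S -> sym_generating T -> 0 <= a ->
  L1_compressible (word_dist R S) a -> L1_compressible (word_dist R T) a.
Proof.
move=> gS gT a0 /(L1_compressibleP _ _ (1%g : G)) cS.
have [K [K1 KST]] := word_metric_comparable gS gT.
have [K' [K'1 KTS]] := word_metric_comparable gT gS.
apply/(L1_compressibleP _ _ (1%g : G)).
apply: (@cut_compressible_comparable _ _ (word_dist R S) _ (Num.max K K'));
  try exact: word_dist_ge0; try exact: a0; try exact: cS.
- by rewrite le_max K1.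
- move=> u v; apply: le_trans (KST u v) _.
  by rewrite ler_wpM2r ?word_dist_ge0// le_max lexx.
- move=> u v; apply: le_trans (KTS u v) _.
  by rewrite ler_wpM2r ?word_dist_ge0// le_max lexx orbT.
Qed.

(** The measure m is scaled by t, chosen from p so that
    exp(- t L) >= 1 - t L = 1 - (1 - p) / 2 > p. *)
Lemma compressible_admissible S a : sym_generating S ->
  L1_compressible (word_dist R S) a -> percolation_admissible S a.
Proof.
move=> gS /(L1_compressibleP _ _ (1%g : G)).
move=> [d [Z [m [A [mA [L0 [c [c0 mLc]]]]]]]].
(* L0 may be nonpositive, whereas both L / c and t * L have to be positive. *)
pose L := Num.max L0 1.
have L_gt0 : 0 < L by rewrite lt_max ltr01 orbT.
exists (L / c); first exact: divr_gt0.
move=> p p1.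
pose t := (1 - p) / (2 * L).
have t_gt0 : 0 < t by rewrite divr_gt0 ?subr_gt0// mulr_gt0.
pose m' : {measure set Z -> \bar R} := mscale (NngNum (ltW t_gt0)) m.
have mL u v : (m (A u `+` A v) <= (L * word_dist R S u v)%:E)%E.
  apply: le_trans (mLc u v).2 _; rewrite lee_fin ler_wpM2r ?word_dist_ge0//.
  by rewrite le_max lexx.
have m_fin u v : m (A u `+` A v) \is a fin_num.
  by rewrite ge0_fin_numE//; apply: le_lt_trans (mL u v) _; rewrite ltry.
have m'E u v : m' (A u `+` A v) = (t * fine (m (A u `+` A v)))%:E.
  by rewrite EFinM fineK.
have m'_fin u v : (m' (A u `+` A v) < +oo)%E by rewrite m'E ltry.
have [en enP] := enumeration gS.
have edgeP e : cayley_edges S e -> exists x y, e = [set x; y].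
  by move=> [g [s [_ ->]]]; exists g, (g * s)%g.
have [P [Pe Pu Pl]] := cut_percolation enP edgeP mA m'_fin.
have edge_le x y : cayley_edges S [set x; y] ->
    fine (m' (A x `+` A y)) <= t * L.
  move=> xy; rewrite m'E /= ler_pM2l// -lee_fin fineK//.
  apply: le_trans (mL x y) _; rewrite lee_fin -[leRHS]mulr1 ler_pM2l//.
  exact: word_dist_edge.
exists P; split.
  move=> e; have [x [y exy]] := edgeP _ (set_mem (valP e)).
  rewrite (Pe e x y exy) lte_fin.
  have tL : t * L = (1 - p) / 2 by rewrite /t; field; rewrite gt_eqF.
  have xy : cayley_edges S [set x; y] by rewrite -exy; exact: set_mem (valP e).
  have := expR_ge1Dx (- fine (m' (A x `+` A y))); have := edge_le _ _ xy.
  lra.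
exists (t * L), (t * c); split; [exact: mulr_gt0|exact: mulr_gt0| |].
  by rewrite -mulf_div divff ?mul1r// gt_eqF.
move=> u v; split.
  have [q uv <-] : exists2 q, is_walk (cayley_edges S) u v q &
      (size q)%:R = word_dist R S u v.
    have [q uv qs] := graph_dist_walk (cayley_connected u v gS).
    by exists q => //; rewrite qs.
  exact: Pl.
apply: le_trans (Pu u v) _; rewrite lee_fin ler_expR lerN2 m'E /=.
by rewrite -mulrA ler_pM2l// -lee_fin fineK//; exact: (mLc u v).1.
Qed.

(** Requiring edge probabilities above exp(- delta) forces gamma < delta,
    since P[x <-> y] <= exp(- gamma) for neighbours x <> y. A group without such
    neighbours is trivial, and then the zero cut metric works. *)
Lemma admissible_compressible S a a' : sym_generating S -> 0 <= a' -> a' < a ->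
  percolation_admissible S a -> L1_compressible (word_dist R S) a'.
Proof.
move=> gS a'0 a'a [C C0 perc].
have [en enP] := enumeration gS.
apply/(L1_compressibleP _ _ (1%g : G)).
have [[x [y [xy xNy]]]|triv] :=
    pselect (exists x y, cayley_edges S [set x; y] /\ x <> y); last first.
  have G1 u v : u = v :> G.
    have [p] := cayley_connected u v gS.
    elim: p u => [|x p IH] u [/=]; first by [].
    move=> /andP[/asboolP ux xp] pv; rewrite -(IH x (conj xp pv)).
    by apply: contrapT => uNx; apply: triv; exists u, x.
  exists _, unit, [the measure _ _ of \d_tt], (fun=> set0); split => //.
  exists 0, 1; split => // u v; rewrite (G1 u v) setYK measure0 word_dist_refl.
  by rewrite /dist_pow eqxx mulr0.
have dxy : word_dist R S x y = 1.
  have : (graph_dist (cayley_edges S) x y <= 1)%N.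
    by rewrite -(ler_nat R); exact: word_dist_edge.
  rewrite /word_dist; case E: (graph_dist _ _ _) => [|[|n]]// _.
  by case: xNy; apply: (word_dist_eq0 gS); rewrite /word_dist E.
apply: (mixture_compressible enP (E := cayley_edges S) _ a'0 a'a C0).
  move=> u v; rewrite /word_dist.
  case: (graph_dist _ _ _) => [|n]; first by left.
  by right; rewrite ler1n.
move=> delta delta0.
have [|P [Pe [b [c [b0 c0 bc Puv]]]]] := perc (expR (- delta)).
  by rewrite expR_lt1 oppr_lt0.
exists P, c; split.
  rewrite c0/=; have [_] := Puv x y.
  rewrite dxy /dist_pow oner_eq0 powR1 mulr1 => Pxy.
  have := lt_le_trans (Pe (SigSub (mem_set xy))) _.
  move=> /(_ (expR (- c))%:E); rewrite lte_fin ltr_expR ltrN2 => h.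
  apply: ltW; apply: h; apply: le_trans Pxy.
  apply: le_measure; rewrite ?inE.
  - exact: measurable_open_edge.
  - exact: measurable_same_cluster.
  - move=> w we; exists [:: y]; split => //=; rewrite andbT; apply/asboolP.
    by exists (SigSub (mem_set xy)).
move=> u v; have [Pl Pu] := Puv u v; split => //; apply: le_trans Pl.
rewrite lee_fin ler_expR lerN2 ler_wpM2r ?word_dist_ge0//.
by rewrite -ler_pdivrMr.
Qed.

End word_metric.

Lemma le_sup_unit (R : realType) (B : set R) (b : R) :
  (forall x, B x -> 0 <= x <= 1) -> B b -> b <= sup B.
Proof.
move=> B01 Bb; apply: sup_upper_bound => //; split; first by exists b.
by exists 1 => x /B01 /andP[].
Qed.

Lemma sup_unit_ge0 (R : realType) (B : set R) :
  (forall x, B x -> 0 <= x <= 1) -> 0 <= sup B.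
Proof.
move=> B01; have [->|/set0P[b Bb]] := eqVneq B set0; first by rewrite sup0.
by apply: le_trans (le_sup_unit B01 Bb); have /andP[] := B01 b Bb.
Qed.

(** For a = 0 the set B may be empty, and then the bound holds because the
    supremum of the empty set is 0. *)
Lemma sup_unit_approx (R : realType) (B : set R) (a : R) :
  (forall x, B x -> 0 <= x <= 1) -> (forall b, 0 <= b -> b < a -> B b) ->
  a <= sup B.
Proof.
move=> B01 aB; have B0 := sup_unit_ge0 B01.
rewrite leNgt; apply/negP => ltBa.
have : (sup B + a) / 2 <= sup B.
  by apply: (le_sup_unit B01); apply: aB; lra.
lra.
Qed.

Lemma sup_unit_le (R : realType) (A B : set R) :
  (forall x, B x -> 0 <= x <= 1) -> (forall a, A a -> a <= sup B) ->
  sup A <= sup B.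
Proof.
move=> B01 AB; have [->|/set0P A0] := eqVneq A set0.
  by rewrite sup0; exact: sup_unit_ge0.
exact: ge_sup.
Qed.

Theorem corollary1p4 (R : realType) (Gamma : groupType) (T S : {fset Gamma}) :
  sym_generating T -> sym_generating S ->
  L1_compression_exponent (word_dist R T) =
  sup [set alpha : R | 0 <= alpha <= 1 /\ percolation_admissible S alpha].
Proof.
move=> gT gS; apply/eqP; rewrite eq_le; apply/andP; split.
  apply: sup_unit_le => [a []//|a [a01 compr]].
  apply: le_sup_unit => [b []//|]; split => //.
  apply: (compressible_admissible gS).
  apply: (compressible_generators gT gS) compr.
  by have /andP[] := a01.
apply: sup_unit_le => [a []//|a [/andP[_ a1] adm]].
apply: sup_unit_approx => [b []//|b b0 ba]; split.
  by rewrite b0 (le_trans (ltW ba) a1).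
apply: (compressible_generators gS gT b0).
exact: admissible_compressible adm.
Qed.
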